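(* Let $E=[0,1]^m\times\mathbb R^n_+$, $d=m+n$, $\mathcal P=\{x_i: i=1,\dots,m+n;\ 1-x_i: i=1,\dots,m\}$, $\mathcal Q=\emptyset$ and $M=\mathbb R^d$. Let $I=\{1,\dots,m\}$ and $J=\{m+1,\dots,m+n\}$. Consider the following conditions. (G1) $\nabla r(x)$, $r\in\mathcal Q$, are linearly independent for all $x\in M$. (G2) $(\mathcal Q\cup\{p\})=\mathcal I(M\cap\{p=0\})$ for each $p\in\mathcal P$. (A0) $a\in\mathbb S^d_+$ on $E$. (A1) $a\nabla p=0$ on $M\cap\{p=0\}$ and $\mathcal Gp>0$ on $E\cap\{p=0\}$ for each $p\in\mathcal P$. (A2) $a\nabla q=0$ and $\mathcal Gq=0$ on $M$ for each $q\in\mathcal Q$. Then (G1)--(G2) hold for the state space $E$. Moreover, the operator $\mathcal G$ satisfies (A0)--(A2) if and only if both of the following hold. (i) The matrix $a$ is given by $$a_{ii}(x)=\gamma_ix_i(1-x_i)\quad(i\in I),$$ $$a_{ij}(x)=0\quad(i\in I,\ j\in I\cup J,\ i\ne j),$$ $$a_{jj}(x)=\alpha_{jj}x_j^2+x_j\left(\phi_j+\psi_{(j)}^\top x_I+\pi_{(j)}^\top x_J\right)\quad(j\in J),$$ $$a_{ij}(x)=\alpha_{ij}x_ix_j\quad(i,j\in J,\ i\ne j)$$ for some $\gamma\in\mathbb R^m_+$, $\psi_{(j)}\in\mathbb R^m$, $\pi_{(j)}\in\mathbb R^n_+$ with $\pi_{(j),j}=0$ ($j\in J$), $\phi\in\mathbb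 R^n$ with $\phi_j\ge(\psi_{(j)}^-)^\top\mathbf 1$, and $\alpha=(\alpha_{ij})_{i,j\in J}\in\mathbb S^n$ such that $\alpha+\mathrm{Diag}(\Pi^\top x_J)\,\mathrm{Diag}(x_J)^{-1}\in\mathbb S^n_+$ for all $x_J\in\mathbb R^n_{++}$, where $\Pi\in\mathbb R^{n\times n}$ is the matrix with columns $\pi_{(j)}$. (ii) The vector $b$ is given by $$b(x)=\begin{pmatrix}\beta_I+B_{II}x_I\\ \beta_J+B_{JI}x_I+B_{JJ}x_J\end{pmatrix}$$ for some $\beta\in\mathbb R^d$ and $B\in\mathbb R^{d\times d}$ such that $(B^-_{i,I\setminus\{i\}})\mathbf 1<\beta_i<-B_{ii}-(B^+_{i,I\setminus\{i\}})\mathbf 1$ for all $i\in I$, $\beta_j>(B^-_{jI})\mathbf 1$ for all $j\in J$, and $B_{JJ}\in\mathbb R^{n\times n}$ has positive off-diagonal entries.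
   Context: $\mathrm{Pol}(\mathbb R^d)$ is the ring of polynomials on $\mathbb R^d$ and $\mathrm{Pol}_k(\mathbb R^d)$ the subspace of polynomials of degree at most $k$. $\mathbb S^d$ denotes the real symmetric $d\times d$ matrices and $\mathbb S^d_+$ the positive semidefinite ones. $\mathbb R_+=[0,\infty)$, $\mathbb R_{++}=(0,\infty)$. For a function $f$ on $\mathbb R^d$, $\{f=0\}=\{x\in\mathbb R^d:f(x)=0\}$. Standing setting: $a:\mathbb R^d\to\mathbb S^d$ and $b:\mathbb R^d\to\mathbb R^d$ satisfy $a_{ij}\in\mathrm{Pol}_2(\mathbb R^d)$ and $b_i\in\mathrm{Pol}_1(\mathbb R^d)$ for all $i,j$, and $\mathcal Gf=\frac12\mathrm{Tr}(a\nabla^2f)+b^\top\nabla f$. For a finite family $\mathcal R$ of polynomials, $(\mathcal R)$ is the ideal of $\mathrm{Pol}(\mathbb R^d)$ generated by $\mathcal R$; for $V\subseteq\mathbb R^d$, $\mathcal I(V)$ is the ideal of all polynomials vanishing on $V$. Notation: $x_I$ (resp. $x_J$) is the subvector of $x\in\mathbb R^d$ of components with indices in $I$ (resp. $J$); $A_{II},A_{IJ}$, etc. are the submatrices of $A\in\mathbb R^{d\times d}$ with the indicated row and column indices. Vectors in $\mathbb R^n$ and matrices in $\mathbb R^{n\times n}$ such as $\phi$, $\pi_{(j)}$, $\alpha$, $\Pi$ are indexed by $J$; $\pi_{(j),j}$ is the component of $\pi_{(j)}$ with index $j$. $v^+$ and $v^-$ denote componentwise positive and negative parts ($v^-=\max(-v,0)\ge0$);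 $\mathbf 1$ is the all-ones vector of appropriate dimension; $\mathrm{Diag}(v)$ is the diagonal matrix with diagonal $v$.
   Formalization: ''Positive off-diagonal entries'' of B_JJ is taken as nonnegative (≥ 0); with strict positivity the ''only if'' direction fails, e.g. m=0, n=2, a=0, b=(1,1), which satisfies (A0)–(A2) with B_JJ=0. *)

(* Defs.v *)
From HB Require Import structures.
From mathcomp Require Import all_boot all_order all_algebra.
From mathcomp Require Import classical_sets reals.
From mathcomp Require Import mpoly.

Set Implicit Arguments.
Unset Strict Implicit.
Unset Printing Implicit Defensive.

Import Order.TTheory GRing.Theory Num.Theory.
Local Open Scope ring_scope.
Local Open Scope classical_set_scope.

(* Points of R^d are column vectors.  Elements of Pol(R^d) are formal
   polynomials {mpoly R[d]}, which over the infinite field R are the same thing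
   as polynomial functions; their partial derivatives are the formal ones. *)

Section Polynomials.
Variables (R : realType) (d : nat).
Implicit Types (p f : {mpoly R[d]}) (x : 'cV[R]_d).
Implicit Types (P Q rs : seq {mpoly R[d]}) (M E V : set 'cV[R]_d).

Definition peval p x : R := p.@[fun i => x i 0].

(* msize is the total degree plus one, and msize 0 = 0. *)
Definition is_Pol (k : nat) (g : 'cV[R]_d -> R) : Prop :=
  exists2 p, (msize p <= k.+1)%N & forall x, g x = peval p x.

Definition grad p x : 'cV[R]_d := \col_i peval (mderiv i p) x.

Definition hess p x : 'M[R]_d :=
  \matrix_(i, j) peval (mderiv i (mderiv j p)) x.

Definition zero_set p : set 'cV[R]_d := [set x | peval p x = 0].

Definition ideal_gen rs : set {mpoly R[d]} :=
  [set f | exists c : 'I_(size rs) -> {mpoly R[d]},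
             f = \sum_(k < size rs) c k * rs`_k].

Definition vanishing_ideal V : set {mpoly R[d]} :=
  [set f | forall x, V x -> peval f x = 0].

Definition psd (k : nat) (A : 'M[R]_k) : Prop :=
  A^T = A /\ forall v : 'cV[R]_k, 0 <= (v^T *m A *m v) 0 0.

Definition generator (a : 'cV[R]_d -> 'M[R]_d) (b : 'cV[R]_d -> 'cV[R]_d)
    f x : R :=
  2^-1 * \tr (a x *m hess f x) + ((b x)^T *m grad f x) 0 0.

Definition condG1 M Q : Prop :=
  forall x, M x -> row_free (\matrix_(k < size Q) (grad Q`_k x)^T).

Definition condG2 M P Q : Prop :=
  forall p, p \in P ->
    ideal_gen (rcons Q p) = vanishing_ideal (M `&` zero_set p).

Definition condA0 E (a : 'cV[R]_d -> 'M[R]_d) : Prop :=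
  forall x, E x -> psd (a x).

Definition condA1 M E P (a : 'cV[R]_d -> 'M[R]_d) (b : 'cV[R]_d -> 'cV[R]_d)
    : Prop :=
  forall p, p \in P ->
    (forall x, (M `&` zero_set p) x -> a x *m grad p x = 0) /\
    (forall x, (E `&` zero_set p) x -> 0 < generator a b p x).

Definition condA2 M Q (a : 'cV[R]_d -> 'M[R]_d) (b : 'cV[R]_d -> 'cV[R]_d)
    : Prop :=
  forall q, q \in Q ->
    (forall x, M x -> a x *m grad q x = 0) /\
    (forall x, M x -> generator a b q x = 0).

End Polynomials.

Arguments condG1 {R d} M Q.
Arguments condG2 {R d} M P Q.
Arguments condA0 {R d} E a.
Arguments condA1 {R d} M E P a b.
Arguments condA2 {R d} M Q a b.

(* In 'I_(m + n), the index set I = {1..m} is the image of lshift n and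
   J = {m+1..m+n} is the image of rshift m; accordingly x_I = usubmx x,
   x_J = dsubmx x, B_II = ulsubmx B, B_JI = dlsubmx B, B_JJ = drsubmx B. *)

Section CubeOrthant.
Variables (R : realType) (m n : nat).

Definition stateE : set 'cV[R]_(m + n) :=
  [set x | (forall i : 'I_m, 0 <= x (lshift n i) 0 <= 1) /\
           (forall j : 'I_n, 0 <= x (rshift m j) 0)].

Definition polysP : seq {mpoly R[m + n]} :=
  [seq 'X_i | i <- enum 'I_(m + n)] ++
  [seq 1 - 'X_(lshift n i) | i <- enum 'I_m].

Definition polysQ : seq {mpoly R[m + n]} := [::].

Definition manifoldM : set 'cV[R]_(m + n) := setT.

Definition pospart (r : R) : R := Num.max r 0.
Definition negpart (r : R) : R := Num.max (- r) 0.

Definition ones (k : nat) : 'cV[R]_k := const_mx 1.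

Definition Diag (k : nat) (v : 'cV[R]_k) : 'M[R]_k := diag_mx v^T.

Definition form_a (a : 'cV[R]_(m + n) -> 'M[R]_(m + n)) : Prop :=
  exists (gamma : 'cV[R]_m) (psi : 'I_n -> 'cV[R]_m) (pi : 'I_n -> 'cV[R]_n)
         (phi : 'cV[R]_n) (alpha : 'M[R]_n),
    let Pi : 'M[R]_n := \matrix_(k, j) pi j k 0 in
    [/\ [/\ forall i, 0 <= gamma i 0,
            forall j k, 0 <= pi j k 0 & forall j, pi j j 0 = 0],
        forall j, ((map_mx negpart (psi j))^T *m ones m) 0 0 <= phi j 0,
        alpha^T = alpha,
        forall xJ : 'cV[R]_n, (forall j, 0 < xJ j 0) ->
          psd (alpha + Diag (Pi^T *m xJ) *m invmx (Diag xJ))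
      & forall x : 'cV[R]_(m + n),
        let xI := usubmx x in
        let xJ := dsubmx x in
        [/\ forall i : 'I_m,
              a x (lshift n i) (lshift n i) =
                gamma i 0 * xI i 0 * (1 - xI i 0),
            forall (i : 'I_m) (j : 'I_(m + n)), lshift n i != j ->
              a x (lshift n i) j = 0,
            forall j : 'I_n,
              a x (rshift m j) (rshift m j) =
                alpha j j * xJ j 0 ^+ 2 +
                xJ j 0 * (phi j 0 + ((psi j)^T *m xI) 0 0
                                  + ((pi j)^T *m xJ) 0 0)
          & forall i j : 'I_n, i != j ->
              a x (rshift m i) (rshift m j) = alpha i j * xJ i 0 * xJ j 0]].

(* "Positive off-diagonal entries" of B_JJ is meant in the weak sense: for
   j <> k in J, B_jk = 0 is compatible with G x_j > 0 on E `&` {x_j = 0}, e.g.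
   when a = 0, m = 0, and b is a constant vector with positive entries. *)
Definition form_b (b : 'cV[R]_(m + n) -> 'cV[R]_(m + n)) : Prop :=
  exists (beta : 'cV[R]_(m + n)) (B : 'M[R]_(m + n)),
    let betaI := usubmx beta in let betaJ := dsubmx beta in
    let BII := ulsubmx B in let BJI := dlsubmx B in let BJJ := drsubmx B in
    [/\ forall i : 'I_m,
          \sum_(k < m | k != i) negpart (BII i k) < betaI i 0 /\
          betaI i 0 < - BII i i - \sum_(k < m | k != i) pospart (BII i k),
        forall j : 'I_n, (map_mx negpart BJI *m ones m) j 0 < betaJ j 0,
        forall j k : 'I_n, j != k -> 0 <= BJJ j k
      & forall x : 'cV[R]_(m + n),
          b x = col_mx (betaI + BII *m usubmx x)
                       (betaJ + BJI *m usubmx x + BJJ *m dsubmx x)].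

End CubeOrthant.

Arguments stateE R m n : clear implicits.
Arguments polysP R m n : clear implicits.
Arguments polysQ R m n : clear implicits.
Arguments manifoldM R m n : clear implicits.

(* Main.v *)
Require Import Defs.
From HB Require Import structures.
From mathcomp Require Import all_boot all_order all_algebra.
From mathcomp Require Import classical_sets reals.
From mathcomp Require Import mpoly.
From mathcomp Require Import ring lra.

Import Order.TTheory GRing.Theory Num.Theory.
Local Open Scope ring_scope.

(** Why the equivalence holds.  The proof has an algebraic half, which fixes
    the shape of [a] up to constants, and a half of elementary inequalities,
    which turns positivity on E into constraints on those constants.

    Algebra.  Dividing by the linear polynomial x_k - c leaves as remainder the
    polynomial with c substituted for x_k, and a polynomial over an infinite
    field that vanishes pointwise is zero ([mpoly_eq0_of_peval]).  So x_k - c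
    divides every polynomial vanishing on {x_k = c} ([factor_coord]); this is
    [condG2], and it is the reason why tangency of [a] to the faces is so
    restrictive.  Every column k of [a] vanishes on {x_k = 0}, and also on
    {x_k = 1} when k is in I.  Hence a_ii is a quadratic divisible by
    x_i (1 - x_i); an entry a_ik with i in I and k <> i is a quadratic with
    three coprime linear factors, hence zero; for j <> k in J, a_jk is a constant
    times x_j x_k, and a_jj is x_j times an affine function
    ([tangential_shape]).

    Positivity of [a].  With y = x_J, w = v_J, the quadratic form of a(x) splits
    ([quad_form_shape]) into a diagonal part over I, a diagonal part with weights
    y_j (phi_j + psi_(j)^T x_I), and a form in y, homogeneous of degree two,
    whose matrix depends on w only ([state_form]).  For y > 0 and
    w_j = z_j / y_j the last one is the value at z of
    alpha + Diag(Pi^T y) Diag(y)^-1 ([quad_form_S]).  Scaling y by r and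
    letting r tend to infinity isolates this degree-two part; letting r tend
    to 0 isolates the bound on phi; conversely the degree-two part is
    nonnegative at y > 0, hence at y >= 0 by letting y approach the boundary.

    Drift.  On {x_k = 0} and {x_i = 1} the generator only sees b_k and - b_i.
    These are affine functions, whose extrema over the unit cube are given by
    the negative and positive parts of the coefficients ([sum_box_min],
    [sum_box_max]), and whose slopes in the unbounded directions must be
    nonnegative.  For i in I both faces apply, so the slope in each
    direction of J has both signs and vanishes. *)

(** * Polynomials vanishing on a coordinate hyperplane *)

(** Uniqueness of base-N digits.  It makes the Kronecker substitution
    x_i := t ^ (N ^ i) injective on the monomials of exponents below N. *)
Lemma base_expansion_inj (N n : nat) (u v : 'I_n -> nat) :
  (forall i, (u i < N)%N) -> (forall i, (v i < N)%N) ->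
  (\sum_(i < n) u i * N ^ i = \sum_(i < n) v i * N ^ i)%N -> u =1 v.
Proof.
elim: n u v => [|n IHn] u v ltu ltv; first by move=> _ [].
rewrite !big_ord_recl /= !expn0 !muln1.
have shift (w : 'I_n.+1 -> nat) :
    (\sum_(i < n) w (lift ord0 i) * N ^ bump 0 i
     = (\sum_(i < n) w (lift ord0 i) * N ^ i) * N)%N.
  by rewrite big_distrl; apply: eq_bigr => i _; rewrite /bump /= expnS mulnCA mulnC.
rewrite !shift => eq_uv.
have Ngt0 : (0 < N)%N by exact: leq_ltn_trans (ltu ord0).
have eq0 : u ord0 = v ord0.
  by move/(congr1 (modn^~ N)): eq_uv; rewrite ![(_ + _ * N)%N]addnC !modnMDl !modn_small.
have/IHn eqS : (\sum_(i < n) u (lift ord0 i) * N ^ i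
             = \sum_(i < n) v (lift ord0 i) * N ^ i)%N.
  move: eq_uv; rewrite eq0 => /addnI/eqP; rewrite eqn_pmul2r // => /eqP //.
move=> i; case: (unliftP ord0 i) => [j ->|-> //].
by apply: eqS.
Qed.

Section Polynomials.
Variables (R : realType) (d : nat).
Implicit Types (p q : {mpoly R[d]}) (x : 'cV[R]_d).

Lemma poly_eq0_of_horner (p : {poly R}) : (forall t, p.[t] = 0) -> p = 0.
Proof.
move=> p0; apply/eqP; apply: contraT => pN0.
have := @max_poly_roots R p [seq i%:R | i <- iota 0 (size p)] pN0.
rewrite size_map size_iota ltnn; apply.
  by apply/allP => t _; rewrite /root p0.
by rewrite map_inj_uniq ?iota_uniq // => i j /eqP; rewrite eqr_nat => /eqP.
Qed.

(** Kronecker substitution: with N larger than all exponents in [p], putting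
    x_i := t ^ (N ^ i) sends distinct monomials of [p] to distinct powers of t,
    so the coefficients of [p] are those of a univariate polynomial with
    infinitely many roots. *)
Lemma mpoly_eq0_of_peval p : (forall x, peval p x = 0) -> p = 0.
Proof.
move=> p0; pose N := msize p.
pose code (mm : 'X_{1..d}) := (\sum_(i < d) mm i * N ^ i)%N.
have code_inj : {in msupp p &, injective code}.
  move=> m1 m2 m1p m2p eq_code; apply/mnmP; apply: base_expansion_inj eq_code.
    move=> i; apply: leq_ltn_trans (msize_mdeg_lt m1p).
    by rewrite mdegE (bigD1 i) //= leq_addr.
  move=> i; apply: leq_ltn_trans (msize_mdeg_lt m2p).
  by rewrite mdegE (bigD1 i) //= leq_addr.
pose q : {poly R} := \sum_(mm <- msupp p) p@_mm *: 'X^(code mm).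
have q0 : q = 0.
  apply: poly_eq0_of_horner => t.
  rewrite -(p0 (\col_i t ^+ (N ^ i))) /peval mevalE /q horner_sum.
  apply: eq_bigr => mm _; rewrite hornerZ hornerXn; congr (_ * _).
  rewrite /code expr_sum; apply: eq_bigr => i _.
  by rewrite mxE -exprM mulnC.
apply/mpolyP => m0; rewrite mcoeff0.
case: (boolP (m0 \in msupp p)) => [m0p|]; last exact: memN_msupp_eq0.
have := coef0 R (code m0); rewrite -q0 coef_sum (bigD1_seq m0) ?msupp_uniq //=.
rewrite coefZ coefXn eqxx mulr1 big_seq_cond big1 ?addr0 // => mm /andP[mmp ne].
rewrite coefZ coefXn; case: eqP => [/code_inj|]; last by rewrite mulr0.
by move=> /(_ m0p mmp) eqm; rewrite eqm eqxx in ne.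
Qed.

Definition subst_coord (k : 'I_d) (c : R) p : {mpoly R[d]} :=
  p \mPo [tuple if i == k then c%:MP else 'X_i | i < d].

Lemma peval_subst_coord k c p x :
  peval (subst_coord k c p) x = peval p (\col_i if i == k then c else x i 0).
Proof.
rewrite /peval /subst_coord comp_mpoly_meval; apply: meval_eq => i.
by rewrite tnth_mktuple mxE; case: eqP => _; rewrite ?mevalC ?mevalXU.
Qed.

Lemma subst_coordX k c i :
  subst_coord k c 'X_i = if i == k then c%:MP else 'X_i.
Proof. by rewrite /subst_coord comp_mpolyXU -tnth_nth tnth_mktuple. Qed.

(** Substitution is a ring morphism, and the polynomials satisfying this
    congruence contain the constants and the variables and are closed under
    sums and products. *)
Lemma sub_subst_coord_dvd k c p :
  exists q, p - subst_coord k c p = ('X_k - c%:MP) * q.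
Proof.
pose P p := exists q, p - subst_coord k c p = ('X_k - c%:MP) * q.
have PM p1 p2 : P p1 -> P p2 -> P (p1 * p2).
  move=> [q1 e1] [q2 e2]; exists (q1 * p2 + subst_coord k c p1 * q2).
  rewrite /subst_coord rmorphM /=.
  rewrite mulrDr mulrA -e1 mulrCA -e2 /subst_coord; ring.
have PC e : P e%:MP.
  by exists 0; rewrite /subst_coord comp_mpolyC subrr mulr0.
have PX i : P 'X_i.
  rewrite /P subst_coordX; case: eqP => [->|_]; first by exists 1; rewrite mulr1.
  by exists 0; rewrite subrr mulr0.
rewrite -/(P p); elim/mpolyind: p => [|e mm q _ _ [q2 e2]]; first exact: (PC 0).
have [q1 e1] : P (e *: 'X_[mm]).
  rewrite -mul_mpolyC; apply: (PM) => //; rewrite mpolyXE_id.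
  apply: (big_ind P); [by rewrite -mpolyC1; apply: (PC) | exact: PM | move=> i _].
  elim: (mm i) => [|j IH]; last by rewrite exprS; apply: (PM).
  by rewrite expr0 -mpolyC1; apply: (PC).
exists (q1 + q2); rewrite mulrDr -e1 -e2 /subst_coord rmorphD /=; ring.
Qed.

Lemma factor_coord k c p : (forall x, x k 0 = c -> peval p x = 0) ->
  exists q, p = ('X_k - c%:MP) * q.
Proof.
move=> p0; have [q e] := sub_subst_coord_dvd k c p; exists q; rewrite -e.
suff -> : subst_coord k c p = 0 by rewrite subr0.
apply: mpoly_eq0_of_peval => x; rewrite peval_subst_coord; apply: p0.
by rewrite mxE eqxx.
Qed.

Lemma mpolyXBC_neq0 k (c : R) : 'X_k - c%:MP != 0 :> {mpoly R[d]}.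
Proof.
apply/eqP => /(congr1 (mcoeff U_(k))) /eqP.
rewrite mcoeffB mcoeffXU eqxx mcoeffC mnm1_eq0 mulr0 subr0 mcoeff0.
by rewrite oner_eq0.
Qed.

(** The ideal (X_l - e) is prime and does not contain X_k - c: substituting e
    for x_l leaves that factor unchanged, so it kills [p] itself.  Working with
    polynomials avoids arguing about points where x_k = c. *)
Lemma factor_coord_prime k c l e p : k != l ->
  (forall x, x l 0 = e -> peval (('X_k - c%:MP) * p) x = 0) ->
  exists q, p = ('X_l - e%:MP) * q.
Proof.
move=> ne p0; have [q eq_q] := sub_subst_coord_dvd l e p; exists q.
rewrite -eq_q; suff -> : subst_coord l e p = 0 by rewrite subr0.
have : subst_coord l e (('X_k - c%:MP) * p) = 0.
  apply: mpoly_eq0_of_peval => x; rewrite peval_subst_coord; apply: p0.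
  by rewrite mxE eqxx.
rewrite /subst_coord rmorphM rmorphB /= -!/(subst_coord l e _) subst_coordX.
rewrite (negbTE ne) {1}/subst_coord comp_mpolyC => /eqP.
by rewrite mulf_eq0 (negbTE (mpolyXBC_neq0 _ _)) => /eqP.
Qed.

(** Each linear factor that is split off costs one degree; this is how the degree
    bounds on [a] and [b] turn cofactors into affine functions or constants. *)
Lemma msizeXBCM k (c : R) p : p != 0 ->
  msize (('X_k - c%:MP) * p) = (msize p).+1.
Proof.
move=> pN0; rewrite msizeM ?mpolyXBC_neq0 //.
suff -> : msize ('X_k - c%:MP : {mpoly R[d]}) = 2 by [].
apply/eqP; rewrite eqn_leq; apply/andP; split.
  apply: leq_trans (msizeD_le _ _) _.
  by rewrite mmeasureN mmeasureC msizeX mdeg1; case: (c != 0).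
have : U_(k)%MM \in msupp ('X_k - c%:MP : {mpoly R[d]}).
  by rewrite mcoeff_msupp mcoeffB mcoeffXU eqxx mcoeffC mnm1_eq0 mulr0 subr0 oner_eq0.
by move/msize_mdeg_lt; rewrite mdeg1.
Qed.

Lemma msizeXBCM_le k (c : R) p s :
  (msize (('X_k - c%:MP) * p)%R <= s.+1)%N -> (msize p <= s)%N.
Proof.
by case: (eqVneq p 0) => [->|pN0]; rewrite ?msize0 // msizeXBCM.
Qed.

Lemma pevalXBCM k c p x :
  peval (('X_k - c%:MP) * p) x = (x k 0 - c) * peval p x.
Proof. by rewrite /peval mevalM mevalB mevalXU mevalC. Qed.

Lemma peval_const p x : (msize p <= 1)%N -> peval p x = p@_0.
Proof. by move/msize1_polyC => {1}->; rewrite /peval mevalC. Qed.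

Lemma peval_affine p x : (msize p <= 2)%N ->
  peval p x = p@_0 + \sum_(i < d) p@_U_(i) * x i 0.
Proof.
move=> szp; pose q : {mpoly R[d]} := (p@_0)%:MP + \sum_(i < d) p@_U_(i) *: 'X_i.
suff -> : peval p x = peval q x.
  rewrite /peval mevalD mevalC raddf_sum /=; congr (_ + _).
  by apply: eq_bigr => i _; rewrite mevalZ mevalXU.
congr (peval _ x); apply/mpolyP => mm; rewrite mcoeffD mcoeffC raddf_sum /=.
have [->|mmN0] := eqVneq mm 0%MM.
  rewrite mulr1 big1 ?addr0 // => i _.
  by rewrite mcoeffZ mcoeffX mnm1_eq0 mulr0.
rewrite mulr0 add0r.
have [/existsP[i /eqP->]|/existsPn noU] := boolP [exists i : 'I_d, mm == U_(i)%MM].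
  rewrite (bigD1 i) //= mcoeffZ mcoeffXU eqxx mulr1 big1 ?addr0 // => j ne.
  by rewrite mcoeffZ mcoeffXU (negbTE ne) mulr0.
rewrite big1 => [|i _]; last first.
  by rewrite mcoeffZ mcoeffX eq_sym (negbTE (noU i)) mulr0.
apply/memN_msupp_eq0/msize_mdeg_ge/(leq_trans szp).
have : mdeg mm != 1%N by rewrite mdeg_eq1; apply/existsPn.
by case E : (mdeg mm) => [|[]] //; move/eqP: E; rewrite mdeg_eq0 (negbTE mmN0).
Qed.

End Polynomials.

(** * Quadratic functions vanishing on faces *)

Section QuadraticsOnFaces.
Variables (R : realType) (d : nat).
Implicit Types (f : 'cV[R]_d -> R) (x : 'cV[R]_d).

Lemma is_Pol1_affine f : is_Pol 1 f ->
  exists cu : R * ('I_d -> R), forall x, f x = cu.1 + \sum_i cu.2 i * x i 0.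
Proof.
by move=> [p szp fp]; exists (p@_0, fun i => p@_U_(i)) => x; rewrite fp peval_affine.
Qed.

Lemma is_Pol_face k c s f :
  is_Pol s.+1 f -> (forall x, x k 0 = c -> f x = 0) ->
  exists2 g, is_Pol s g & forall x, f x = (x k 0 - c) * g x.
Proof.
move=> [p szp fp] f0; have [q pq] : exists q, p = ('X_k - c%:MP) * q.
  by apply: factor_coord => x /f0; rewrite fp.
exists (peval q); last by move=> x; rewrite fp pq pevalXBCM.
by exists q => //; move: szp; rewrite pq => /msizeXBCM_le.
Qed.

Lemma is_Pol_face2 k c l e s f : k != l ->
  is_Pol s.+2 f -> (forall x, x k 0 = c -> f x = 0) ->
  (forall x, x l 0 = e -> f x = 0) ->
  exists2 g, is_Pol s g & forall x, f x = (x k 0 - c) * (x l 0 - e) * g x.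
Proof.
move=> ne [p szp fp] fk fl.
have [q pq] : exists q, p = ('X_k - c%:MP) * q.
  by apply: factor_coord => x /fk; rewrite fp.
have [r qr] : exists r, q = ('X_l - e%:MP) * r.
  by apply: (@factor_coord_prime R d k c l e) ne _ => x; rewrite -pq -fp; apply: fl.
exists (peval r); last by move=> x; rewrite fp pq qr !pevalXBCM mulrA.
by exists r => //; move: szp; rewrite pq qr => /msizeXBCM_le/msizeXBCM_le.
Qed.

Lemma is_Pol0_const f : is_Pol 0 f -> exists c, forall x, f x = c.
Proof. by move=> [p szp fp]; exists p@_0 => x; rewrite fp peval_const. Qed.

Lemma quadratic_face k f :
  is_Pol 2 f -> (forall x, x k 0 = 0 -> f x = 0) ->
  exists cu : R * ('I_d -> R),
    forall x, f x = x k 0 * (cu.1 + \sum_i cu.2 i * x i 0).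
Proof.
move=> f2 /(is_Pol_face _ _ _ _ f2)[g /is_Pol1_affine[cu gE] fE].
by exists cu => x; rewrite fE subr0 gE.
Qed.

Lemma quadratic_opposite_faces k f : is_Pol 2 f ->
  (forall x, x k 0 = 0 -> f x = 0) -> (forall x, x k 0 = 1 -> f x = 0) ->
  exists c, forall x, f x = c * x k 0 * (1 - x k 0).
Proof.
move=> f2 /(is_Pol_face _ _ _ _ f2)[g g1 fE] f1.
have g_face x : x k 0 = 1 -> g x = 0.
  by move=> xk; have := f1 _ xk; rewrite fE xk subr0 mul1r.
have [h /is_Pol0_const[c hE] gE] := is_Pol_face _ _ _ _ g1 g_face.
by exists (- c) => x; rewrite fE gE hE; ring.
Qed.

Lemma quadratic_two_faces k l f : k != l -> is_Pol 2 f ->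
  (forall x, x k 0 = 0 -> f x = 0) -> (forall x, x l 0 = 0 -> f x = 0) ->
  exists c, forall x, f x = c * x k 0 * x l 0.
Proof.
move=> ne f2 fk fl.
have [g /is_Pol0_const[c gE] fE] := is_Pol_face2 _ _ _ _ _ _ ne f2 fk fl.
by exists c => x; rewrite fE gE; ring.
Qed.

(** Three distinct linear factors do not fit into degree two.  After two of
    them, c x_k x_l remains, and the value at the all-ones point, which lies
    on {x_k = 1}, is c. *)
Lemma quadratic_three_faces k l f : k != l -> is_Pol 2 f ->
  (forall x, x k 0 = 0 -> f x = 0) -> (forall x, x k 0 = 1 -> f x = 0) ->
  (forall x, x l 0 = 0 -> f x = 0) -> forall x, f x = 0.
Proof.
move=> ne f2 fk0 fk1 fl.
have [c fE] := quadratic_two_faces _ _ _ ne f2 fk0 fl.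
have := fk1 (const_mx 1); rewrite fE !mxE !mulr1 => /(_ erefl) c0 x.
by rewrite fE c0 !mul0r.
Qed.

End QuadraticsOnFaces.

(** * Inequalities over half-lines and boxes *)

Section RealInequalities.
Variable R : realType.
Implicit Types c u v r : R.

(** Continuity at 0 from the right, made explicit: were c < 0, then at
    r = - c / (|u| + |v| + 1 - c) <= 1 the other terms are at most
    (|u| + |v|) r < - c. *)
Lemma quadratic_ge0_at0 c u v :
  (forall r, 0 < r -> 0 <= c + u * r + v * r ^+ 2) -> 0 <= c.
Proof.
move=> h; rewrite leNgt; apply/negP => c0.
pose K := `|u| + `|v| + 1 - c.
have u0 := normr_ge0 u; have v0 := normr_ge0 v.
have K0 : 0 < K by rewrite /K; lra.
pose r := - c / K.
have r0 : 0 < r by rewrite divr_gt0 // oppr_gt0.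
have rK : r * K = - c by rewrite /r divfK // gt_eqF.
have r1 : r <= 1 by rewrite ler_pdivrMr // mul1r /K; lra.
have ur : u * r <= `|u| * r by rewrite ler_wpM2r ?(ltW r0) // ler_norm.
have vr : v * r ^+ 2 <= `|v| * r.
  rewrite expr2 mulrA; apply: le_trans (_ : `|v| * r * r <= _).
    by rewrite ler_wpM2r ?(ltW r0) // ler_wpM2r ?(ltW r0) // ler_norm.
  by rewrite ler_piMr // mulr_ge0 // ltW.
have := h r r0; move: rK; rewrite /K; nra.
Qed.

Lemma affine_ge0_at0 c u : (forall r, 0 < r -> 0 <= c + u * r) -> 0 <= c.
Proof.
move=> h; apply: (quadratic_ge0_at0 c u 0) => r r0.
by rewrite mul0r addr0; apply: h.
Qed.

(** Divide by r and let r tend to infinity, that is, exchange the roles of the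
    two coefficients through r |-> 1 / r. *)
Lemma affine_ge0_slope c u : (forall r, 0 < r -> 0 <= c + u * r) -> 0 <= u.
Proof.
move=> h; apply: (affine_ge0_at0 u c) => r r0.
have := h r^-1; rewrite invr_gt0 => /(_ r0).
rewrite -(pmulr_lge0 _ r0) mulrDl mulfVK ?gt_eqF //; last lra.
Qed.

Lemma sum_box_ge (m : nat) (P : pred 'I_m) (u s : 'I_m -> R) :
  (forall k, 0 <= s k <= 1) ->
  - \sum_(k | P k) negpart (u k) <= \sum_(k | P k) u k * s k.
Proof.
move=> s01; rewrite -sumrN; apply: ler_sum => k _.
have /andP[s0 s1] := s01 k; rewrite /negpart maxEle; case: ifP => ?; nra.
Qed.

Lemma sum_box_le (m : nat) (P : pred 'I_m) (u s : 'I_m -> R) :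
  (forall k, 0 <= s k <= 1) ->
  \sum_(k | P k) u k * s k <= \sum_(k | P k) pospart (u k).
Proof.
move=> s01; apply: ler_sum => k _.
have /andP[s0 s1] := s01 k; rewrite /pospart maxEle; case: ifP => ?; nra.
Qed.

(** The bound of [sum_box_ge] is attained at the vertex that switches on exactly
    the nonpositive coefficients; [sum_box_max] is the mirror image. *)
Lemma sum_box_min (m : nat) (P : pred 'I_m) (u : 'I_m -> R) :
  \sum_(k | P k) u k * (u k <= 0)%R%:R = - \sum_(k | P k) negpart (u k).
Proof.
rewrite -sumrN; apply: eq_bigr => k _; rewrite /negpart maxEle oppr_le0.
by case: (leP (u k) 0) => u0; case: leP => ? //=; lra.
Qed.

Lemma sum_box_max (m : nat) (P : pred 'I_m) (u : 'I_m -> R) :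
  \sum_(k | P k) u k * (0 <= u k)%R%:R = \sum_(k | P k) pospart (u k).
Proof.
apply: eq_bigr => k _; rewrite /pospart maxEle.
by case: (leP (u k) 0) => u0; case: leP => ? //=; lra.
Qed.

Lemma bool_box (c : bool) : 0 <= (c%:R : R) <= 1.
Proof. by case: c; rewrite ?lexx ler01. Qed.

End RealInequalities.

(** * The boundary conditions in coordinates *)

Section BoundaryConditions.
Variables (R : realType) (m n : nat).
Variables (a : 'cV[R]_(m + n) -> 'M[R]_(m + n)).
Variables (b : 'cV[R]_(m + n) -> 'cV[R]_(m + n)).
Implicit Types x : 'cV[R]_(m + n).

Definition cat_point (s : 'I_m -> R) (t : 'I_n -> R) : 'cV[R]_(m + n) :=
  col_mx (\col_i s i) (\col_j t j).

Lemma cat_pointI s t i : cat_point s t (lshift n i) 0 = s i.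
Proof. by rewrite col_mxEu mxE. Qed.

Lemma cat_pointJ s t j : cat_point s t (rshift m j) 0 = t j.
Proof. by rewrite col_mxEd mxE. Qed.

Lemma cat_point_stateE s t : (forall i, 0 <= s i <= 1) -> (forall j, 0 <= t j) ->
  stateE R m n (cat_point s t).
Proof. by move=> s01 t0; split=> [i|j]; rewrite ?cat_pointI ?cat_pointJ. Qed.

Lemma mderivXU i k : mderiv i ('X_k : {mpoly R[m + n]}) = (i == k)%:R%:MP.
Proof.
rewrite mderivX mnm1E eq_sym; case: eqVneq => [->|_]; last first.
  by rewrite scale0r mpolyC0.
have -> : (U_(k) - U_(k) = 0 :> 'X_{1..m + n})%MM.
  by apply/mnmP => l; rewrite mnmBE subnn mnm0E.
by rewrite mpolyX0 scale1r mpolyC1.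
Qed.

Lemma gradX k x : grad 'X_k x = delta_mx k 0.
Proof. by apply/colP => i; rewrite !mxE mderivXU /peval mevalC andbT. Qed.

Lemma grad1BX k x : grad (1 - 'X_k) x = - delta_mx k 0.
Proof.
rewrite -(gradX _ x); apply/colP => i; rewrite !mxE mderivB.
by rewrite -mpolyC1 mderivC sub0r /peval mevalN.
Qed.

Lemma hessX k x : hess 'X_k x = 0.
Proof.
by apply/matrixP => i j; rewrite !mxE mderivXU mderivC /peval meval0.
Qed.

Lemma hess1BX k x : hess (1 - 'X_k) x = 0.
Proof.
rewrite -oppr0 -(hessX k x); apply/matrixP => i j; rewrite !mxE.
by rewrite mderivB -mpolyC1 mderivC sub0r mderivN /peval mevalN.
Qed.

Lemma generatorX k x : generator a b 'X_k x = b x k 0.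
Proof.
rewrite /generator hessX gradX mulmx0 mxtrace0 mulr0 add0r.
by rewrite -colE !mxE.
Qed.

Lemma generator1BX k x : generator a b (1 - 'X_k) x = - b x k 0.
Proof.
rewrite /generator hess1BX grad1BX mulmx0 mxtrace0 mulr0 add0r mulmxN.
by rewrite -colE !mxE.
Qed.

Lemma zero_setX k x : zero_set ('X_k : {mpoly R[m + n]}) x <-> x k 0 = 0.
Proof. by rewrite /zero_set /= /peval mevalXU. Qed.

Lemma zero_set1BX k x :
  zero_set (1 - 'X_k : {mpoly R[m + n]}) x <-> x k 0 = 1.
Proof.
rewrite /zero_set /= /peval mevalB meval1 mevalXU; split => [|->]; last by rewrite subrr.
by move/eqP; rewrite subr_eq0 => /eqP.
Qed.

(** The two halves of [condA1] for the coordinate faces: since the defining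
    polynomials are affine with gradient plus or minus a basis vector, only columns
    of [a] and entries of [b] are involved. *)
Definition tangential : Prop :=
  (forall k x, x k 0 = 0 -> forall i, a x i k = 0) /\
  (forall i0 x, x (lshift n i0) 0 = 1 -> forall i, a x i (lshift n i0) = 0).

Definition inward : Prop :=
  (forall k x, stateE R m n x -> x k 0 = 0 -> 0 < b x k 0) /\
  (forall i x, stateE R m n x -> x (lshift n i) 0 = 1 ->
     b x (lshift n i) 0 < 0).

Lemma mulmx_delta_eq0 k x :
  a x *m delta_mx k 0 = 0 :> 'cV_(m + n) <-> forall i, a x i k = 0.
Proof.
rewrite -colE; split => [/colP h i|h]; first by have := h i; rewrite !mxE.
by apply/colP => i; rewrite !mxE h.
Qed.

Lemma condA1P : condA1 (manifoldM R m n) (stateE R m n) (polysP R m n) a b <->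
  tangential /\ inward.
Proof.
split=> [h|[[tan0 tan1] [in0 in1]] p].
  have hX k := h 'X_k; have h1X i := h (1 - 'X_(lshift n i)).
  have memX k : 'X_k \in polysP R m n.
    by rewrite mem_cat; apply/orP; left; apply/mapP; exists k; rewrite ?mem_enum.
  have mem1X i : 1 - 'X_(lshift n i) \in polysP R m n.
    by rewrite mem_cat; apply/orP; right; apply/mapP; exists i; rewrite ?mem_enum.
  split; split=> k x.
  - move=> xk; apply/mulmx_delta_eq0; rewrite -(gradX k x).
    by apply: (hX _ (memX _)).1; split=> //; apply/zero_setX.
  - move=> xk; apply/mulmx_delta_eq0/eqP; rewrite -oppr_eq0 -mulmxN.
    rewrite -(grad1BX _ x); apply/eqP.
    by apply: (h1X _ (mem1X _)).1; split=> //; apply/zero_set1BX.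
  - move=> Ex xk; rewrite -generatorX.
    by apply: (hX _ (memX _)).2; split=> //; apply/zero_setX.
  - move=> Ex xk; rewrite -oppr_gt0 -generator1BX.
    by apply: (h1X _ (mem1X _)).2; split=> //; apply/zero_set1BX.
rewrite mem_cat => /orP[] /mapP[k _ ->]; split=> x [Ex].
- by move/zero_setX => xk; rewrite gradX; apply/mulmx_delta_eq0/tan0.
- by move/zero_setX => xk; rewrite generatorX; apply: in0.
- move/zero_set1BX => xk; rewrite grad1BX mulmxN.
  by apply/eqP; rewrite oppr_eq0; apply/eqP/mulmx_delta_eq0/tan1.
- by move/zero_set1BX => xk; rewrite generator1BX oppr_gt0; apply: in1.
Qed.

End BoundaryConditions.

(** * The drift *)

Section Drift.
Variables (R : realType) (m n : nat).
Variables (b : 'cV[R]_(m + n) -> 'cV[R]_(m + n)).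

(** The constraints are read off at well-chosen points of the faces: vertices
    of the cube give the bounds on beta, and moving along an unbounded
    coordinate gives the signs of slopes. *)
Lemma inwardP : (forall i, is_Pol 1 (fun x => b x i 0)) ->
  inward R m n b -> form_b b.
Proof.
move=> b1 [in0 in1].
have /fin_all_exists[cu bE] i := is_Pol1_affine _ _ _ (b1 i).
pose beta : 'cV[R]_(m + n) := \col_i (cu i).1.
pose B : 'M[R]_(m + n) := \matrix_(i, k) (cu i).2 k.
have bpt i s t : b (cat_point R m n s t) i 0 = beta i 0
    + \sum_(k < m) B i (lshift n k) * s k + \sum_(k < n) B i (rshift m k) * t k.
  rewrite bE big_split_ord addrA !mxE; congr (_ + _ + _);
    by apply: eq_bigr => k _; rewrite ?cat_pointI ?cat_pointJ mxE.
clearbody beta B.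
have sum0 l (u : 'I_l -> R) : \sum_k u k * 0 = 0.
  by rewrite big1 // => k _; rewrite mulr0.
have sumd l (u : 'I_l -> R) k0 r : \sum_k u k * (r * (k == k0)%:R) = u k0 * r.
  rewrite (bigD1 k0) //= eqxx mulr1 big1 ?addr0 // => k /negbTE->.
  by rewrite !mulr0.
have t_ge0 k0 (r : R) : 0 < r -> forall j : 'I_n, 0 <= r * (j == k0)%:R.
  by move=> r0 j; rewrite mulr_ge0 ?ler0n // ltW.
have z01 : 0 <= (0 : R) <= 1 by rewrite lexx ler01.
(* Both faces {x_i = 0} and {x_i = 1} are unbounded in the direction j: the first
   forces the slope to be nonnegative, the second to be nonpositive. *)
have BIJ i j : B (lshift n i) (rshift m j) = 0.
  apply/eqP; rewrite eq_le; apply/andP; split.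
    rewrite -oppr_ge0.
    apply: (affine_ge0_slope _ (- (beta (lshift n i) 0 + B (lshift n i) (lshift n i)))) => r r0.
    have := in1 i (cat_point R m n (fun k => 1 * (k == i)%:R) (fun k => r * (k == j)%:R)).
    rewrite bpt !sumd cat_pointI eqxx !mulr1 => /(_ _ erefl) h.
    apply: ltW; rewrite mulNr -opprD oppr_gt0; apply: h.
    by apply: cat_point_stateE => [k|]; [rewrite mul1r bool_box|exact: t_ge0].
  apply: (affine_ge0_slope _ (beta (lshift n i) 0)) => r r0.
  have := in0 (lshift n i) (cat_point R m n (fun=> 0) (fun k => r * (k == j)%:R)).
  rewrite bpt sumd sum0 addr0 cat_pointI => /(_ _ erefl) h.
  by apply/ltW/h/cat_point_stateE => //; exact: t_ge0.
have BI0 i (t : 'I_n -> R) : \sum_(k < n) B (lshift n i) (rshift m k) * t k = 0.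
  by rewrite big1 // => k _; rewrite BIJ mul0r.
have box_if (i : 'I_m) (c : R) (s : 'I_m -> R) : 0 <= c <= 1 ->
    (forall k, 0 <= s k <= 1) -> forall k, 0 <= (if k == i then c else s k) <= 1.
  by move=> c01 s01 k; case: ifP.
have sum_if (i : 'I_m) (c : R) (u s : 'I_m -> R) :
    \sum_k u k * (if k == i then c else s k) = u i * c + \sum_(k | k != i) u k * s k.
  rewrite (bigD1 i) //= eqxx; congr (_ + _).
  by apply: eq_bigr => k /negbTE->.
have lower i s : (forall k, 0 <= s k <= 1) ->
    0 < beta (lshift n i) 0 + \sum_(k | k != i) B (lshift n i) (lshift n k) * s k.
  move=> s01.
  have := in0 (lshift n i) (cat_point R m n (fun k => if k == i then 0 else s k) (fun=> 0)).
  rewrite bpt BI0 addr0 cat_pointI sum_if eqxx mulr0 add0r => /(_ _ erefl); apply.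
  by apply: cat_point_stateE => //; apply: box_if.
have upper i s : (forall k, 0 <= s k <= 1) ->
    beta (lshift n i) 0 + (B (lshift n i) (lshift n i)
      + \sum_(k | k != i) B (lshift n i) (lshift n k) * s k) < 0.
  move=> s01.
  have := in1 i (cat_point R m n (fun k => if k == i then 1 else s k) (fun=> 0)).
  rewrite bpt BI0 addr0 cat_pointI sum_if eqxx mulr1 => /(_ _ erefl); apply.
  by apply: cat_point_stateE => //; apply: box_if => //; rewrite lexx ler01.
have BIIE i k : ulsubmx B i k = B (lshift n i) (lshift n k).
  by rewrite mxE mxE.
have BJIE j k : dlsubmx B j k = B (rshift m j) (lshift n k).
  by rewrite mxE mxE.
have BJJE j k : drsubmx B j k = B (rshift m j) (rshift m k).
  by rewrite mxE mxE.
have betaIE i : usubmx beta i 0 = beta (lshift n i) 0 by rewrite mxE.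
have betaJE j : dsubmx beta j 0 = beta (rshift m j) 0 by rewrite mxE.
exists beta, B; split.
- move=> i; rewrite BIIE betaIE; split; under eq_bigr do rewrite BIIE.
    rewrite -subr_gt0 -sum_box_min; apply: lower => k; exact: bool_box.
  have := upper i _ (fun k => bool_box R (0 <= B (lshift n i) (lshift n k))).
  by rewrite sum_box_max => h; lra.
- move=> j; rewrite betaJE mxE.
  under eq_bigr do rewrite !mxE mulr1.
  have := in0 (rshift m j) (cat_point R m n
    (fun k => (B (rshift m j) (lshift n k) <= 0)%R%:R) (fun=> 0)).
  rewrite bpt sum0 addr0 cat_pointJ sum_box_min subr_gt0 => /(_ _ erefl); apply.
  by apply: cat_point_stateE => // k; apply: bool_box.
- move=> j k ne; rewrite BJJE.
  apply: (affine_ge0_slope _ (beta (rshift m j) 0)) => r r0.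
  have := in0 (rshift m j) (cat_point R m n (fun=> 0) (fun l => r * (l == k)%:R)).
  rewrite bpt sumd sum0 addr0 cat_pointJ (negbTE ne) mulr0 => /(_ _ erefl) h.
  by apply/ltW/h/cat_point_stateE => //; exact: t_ge0.
move=> x; apply/colP => k.
have -> : x = cat_point R m n (fun i => x (lshift n i) 0) (fun j => x (rshift m j) 0).
  apply/colP => l; case: (splitP l) => j lj.
    have -> : l = lshift n j by apply: val_inj.
    by rewrite cat_pointI.
  have -> : l = rshift m j by apply: val_inj.
  by rewrite cat_pointJ.
rewrite bpt /cat_point col_mxKu col_mxKd.
case: (splitP k) => j kj.
  have -> : k = lshift n j by apply: val_inj.
  rewrite col_mxEu BI0 addr0 mxE betaIE mxE; congr (_ + _).
  by apply: eq_bigr => l _; rewrite BIIE mxE.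
have -> : k = rshift m j by apply: val_inj.
rewrite col_mxEd mxE mxE betaJE; congr (_ + _ + _); rewrite mxE;
  by apply: eq_bigr => l _; rewrite ?BJIE ?BJJE mxE.
Qed.

Lemma form_b_inward : form_b b -> inward R m n b.
Proof.
move=> [beta [B [hI hJ hJJ bE]]].
have bI x i : b x (lshift n i) 0 = beta (lshift n i) 0
    + (ulsubmx B i i * x (lshift n i) 0
       + \sum_(k < m | k != i) ulsubmx B i k * x (lshift n k) 0).
  rewrite bE col_mxEu !mxE (bigD1 i) //= !mxE; congr (_ + (_ + _)).
  by apply: eq_bigr => k _; rewrite !mxE.
have bJ x j : b x (rshift m j) 0 = beta (rshift m j) 0
    + \sum_(k < m) dlsubmx B j k * x (lshift n k) 0
    + (drsubmx B j j * x (rshift m j) 0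
       + \sum_(k < n | k != j) drsubmx B j k * x (rshift m k) 0).
  rewrite bE col_mxEd !mxE (bigD1 (P := xpredT) j) //= !mxE.
  congr (_ + _ + (_ + _)); by apply: eq_bigr => k _; rewrite !mxE.
split=> [k x [xI xJ] xk|i x [xI xJ] xi].
  case: (splitP k) => j kj.
    have ej : k = lshift n j by apply: val_inj.
    move: xk; rewrite ej bI => ->; rewrite mulr0 add0r.
    have [] := hI j; rewrite !mxE => lo _.
    have := @sum_box_ge R m (fun k => k != j) (ulsubmx B j)
      (fun k => x (lshift n k) 0) xI.
    by move=> h; lra.
  have ej : k = rshift m j by apply: val_inj.
  move: xk; rewrite ej bJ => ->; rewrite mulr0 add0r.
  have lo : \sum_k negpart (dlsubmx B j k) < beta (rshift m j) 0.
    have := hJ j; rewrite [dsubmx _ _ _]mxE mxE.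
    by under eq_bigr do rewrite [ones _ _ _ _]mxE mulr1 [(_ ^ _)%sesqui _ _]mxE.
  have := @sum_box_ge R m xpredT (dlsubmx B j) (fun k => x (lshift n k) 0) xI.
  have : 0 <= \sum_(k < n | k != j) drsubmx B j k * x (rshift m k) 0.
    by apply: sumr_ge0 => l ne; rewrite mulr_ge0 // hJJ // eq_sym.
  by move=> ? ?; lra.
rewrite bI xi mulr1; have [_] := hI i; rewrite [usubmx _ _ _]mxE => hi.
have := @sum_box_le R m (fun k => k != i) (ulsubmx B i)
  (fun k => x (lshift n k) 0) xI.
by move=> h; lra.
Qed.

End Drift.

(** * The diffusion matrix *)

Section QuadraticForms.
Variable R : realType.

Lemma quad_formE (l : nat) (A : 'M[R]_l) (v : 'cV[R]_l) :
  (v^T *m A *m v) 0 0 = \sum_i \sum_j v i 0 * A i j * v j 0.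
Proof.
rewrite mxE exchange_big; apply: eq_bigr => j _.
rewrite mxE big_distrl; apply: eq_bigr => i _.
by rewrite mxE.
Qed.

Lemma psd_diag_ge0 (l : nat) (A : 'M[R]_l) i : psd A -> 0 <= A i i.
Proof.
move=> [_ /(_ (delta_mx i 0))].
by rewrite trmx_delta -rowE -colE !mxE.
Qed.

Lemma quad_form_shift (l : nat) (A : 'M[R]_l) (y z : 'cV[R]_l) (r : R) :
  ((y + r *: z)^T *m A *m (y + r *: z)) 0 0 =
  (y^T *m A *m y) 0 0 + ((y^T *m A *m z) 0 0 + (z^T *m A *m y) 0 0) * r
  + (z^T *m A *m z) 0 0 * r ^+ 2.
Proof.
rewrite [(y + r *: z)^T]linearD /= [(r *: z)^T]linearZ /= !mulmxDl !mulmxDr -!scalemxAl -!scalemxAr.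
set e1 := y^T *m A *m y; set e2 := y^T *m A *m z.
set e3 := z^T *m A *m y; set e4 := z^T *m A *m z.
by rewrite !mxE; ring.
Qed.

Lemma quad_formZ (l : nat) (A : 'M[R]_l) (y : 'cV[R]_l) (r : R) :
  ((r *: y)^T *m A *m (r *: y)) 0 0 = (y^T *m A *m y) 0 0 * r ^+ 2.
Proof.
by rewrite [(r *: y)^T]linearZ /= -scalemxAr -!scalemxAl scalerA mxE mulrC expr2.
Qed.

Lemma invmx_Diag (l : nat) (y : 'cV[R]_l) : (forall j, y j 0 != 0) ->
  invmx (Diag y) = Diag (\col_j (y j 0)^-1).
Proof.
move=> y0; have yV : Diag y *m Diag (\col_j (y j 0)^-1) = 1%:M.
  rewrite /Diag mulmx_diag; apply/matrixP => i j; rewrite !mxE.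
  by rewrite mulfV // mulr1n.
have [yU _] := mulmx1_unit yV.
by rewrite -[RHS](mulKmx yU) yV mulmx1.
Qed.

End QuadraticForms.

Section Diffusion.
Variables (R : realType) (m n : nat).
Variables (a : 'cV[R]_(m + n) -> 'M[R]_(m + n)).
Hypothesis a_sym : forall x, (a x)^T = a x.
Implicit Types x : 'cV[R]_(m + n).

(** The formulas for the entries of [a] apart from the inequalities on the
    parameters: tangency gives the former, positivity the latter. *)
Definition has_shape (gamma : 'cV[R]_m) (psi : 'I_n -> 'cV[R]_m)
    (pi : 'I_n -> 'cV[R]_n) (phi : 'cV[R]_n) (alpha : 'M[R]_n) : Prop :=
  forall x : 'cV[R]_(m + n),
    let xI := usubmx x in
    let xJ := dsubmx x in
    [/\ forall i : 'I_m,
          a x (lshift n i) (lshift n i) =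
            gamma i 0 * xI i 0 * (1 - xI i 0),
        forall (i : 'I_m) (j : 'I_(m + n)), lshift n i != j ->
          a x (lshift n i) j = 0,
        forall j : 'I_n,
          a x (rshift m j) (rshift m j) =
            alpha j j * xJ j 0 ^+ 2 +
            xJ j 0 * (phi j 0 + ((psi j)^T *m xI) 0 0
                              + ((pi j)^T *m xJ) 0 0)
      & forall i j : 'I_n, i != j ->
          a x (rshift m i) (rshift m j) = alpha i j * xJ i 0 * xJ j 0].

Lemma a_symE x i j : a x i j = a x j i.
Proof. by rewrite -{1}a_sym mxE. Qed.

(** The linear part of the cofactor of x_j in a_jj is distributed over three
    parameters: its x_I-coefficients form psi_(j), its x_j-coefficient becomes
    alpha_jj, and the other x_J-coefficients form pi_(j), whence
    pi_(j),j = 0. *)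
Lemma tangential_shape : (forall i j, is_Pol 2 (fun x => a x i j)) ->
  tangential R m n a ->
  exists (gamma : 'cV[R]_m) (psi : 'I_n -> 'cV[R]_m)
         (pi : 'I_n -> 'cV[R]_n) (phi : 'cV[R]_n) (alpha : 'M[R]_n),
    [/\ forall j, pi j j 0 = 0, alpha^T = alpha
      & has_shape gamma psi pi phi alpha].
Proof.
move=> a2 [tan0 tan1].
have /fin_all_exists[gamma gammaE] (i : 'I_m) :
    exists c, forall x, a x (lshift n i) (lshift n i) =
      c * x (lshift n i) 0 * (1 - x (lshift n i) 0).
  apply: quadratic_opposite_faces => // x xi; first exact: tan0.
  exact: tan1.
have aI0 x (i : 'I_m) k : lshift n i != k -> a x (lshift n i) k = 0.
  move=> ne; apply: (quadratic_three_faces _ _ _ _ (fun x => a x (lshift n i) k) ne) => // y yi.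
  - by rewrite a_symE tan0.
  - by rewrite a_symE tan1.
  - exact: tan0.
have /fin_all_exists[cu cuE] (j : 'I_n) :
    exists cu : R * ('I_(m + n) -> R),
    forall x, a x (rshift m j) (rshift m j) =
      x (rshift m j) 0 * (cu.1 + \sum_i cu.2 i * x i 0).
  by apply: quadratic_face => // x xj; exact: tan0.
have /fin_all_exists[al alE] (i : 'I_n) : exists al : 'I_n -> R, forall j x, i != j ->
    a x (rshift m i) (rshift m j) = al j * x (rshift m i) 0 * x (rshift m j) 0.
  apply: (fin_all_exists (P := fun j al => forall x, i != j ->
    a x (rshift m i) (rshift m j) = al * x (rshift m i) 0 * x (rshift m j) 0)) => j.
  have [->|ne] := eqVneq i j; first by exists 0.
  have neJ : rshift m i != rshift m j.
    by apply: contra_neq ne; apply: rshift_inj.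
  have [c cE] := quadratic_two_faces _ _ _ _ (fun x => a x (rshift m i) (rshift m j)) neJ (a2 _ _)
    (fun x xi => etrans (a_symE _ _ _) (tan0 _ _ xi _)) (fun x xj => tan0 _ _ xj _).
  by exists c.
exists (\col_i gamma i), (fun j => \col_i (cu j).2 (lshift n i)).
exists (fun j => \col_k if k == j then 0 else (cu j).2 (rshift m k)).
exists (\col_j (cu j).1).
exists (\matrix_(i, j) if i == j then (cu i).2 (rshift m i) else al i j).
split=> [j||x xI xJ].
- by rewrite mxE eqxx.
- (* Symmetry of a, read at the all-ones point, where a_ij = alpha_ij. *)
  apply/matrixP => i j; rewrite !mxE eq_sym; case: eqVneq => [->//|ne].
  have := a_symE (const_mx 1) (rshift m i) (rshift m j).
  have ne' : j != i by rewrite eq_sym.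
  by rewrite (alE i) // (alE j) // !mxE !mulr1.
split=> [i|i j ne|j|i j ne].
- by rewrite gammaE !mxE.
- exact: aI0.
- rewrite cuE !mxE eqxx big_split_ord /= [X in _ + (_ + X)](bigD1 j) //=.
  rewrite [in RHS](bigD1 (P := xpredT) (op := +%R) j) //= !mxE eqxx mul0r add0r.
  rewrite (eq_bigr (fun i => (\col_i0 (cu j).2 (lshift n i0))^T 0 i * xI i 0)); last first.
    by move=> k _; rewrite !mxE.
  rewrite (eq_bigr (fun k => (\col_k0 (if k0 == j then 0 else (cu j).2 (rshift m k0)))^T 0 k * xJ k 0)); last first.
    by move=> k /negbTE ne; rewrite !mxE ne.
  ring.
- by rewrite alE // !mxE (negbTE ne).
Qed.

Section Shape.
Variables (gamma : 'cV[R]_m) (psi : 'I_n -> 'cV[R]_m).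
Variables (pi : 'I_n -> 'cV[R]_n) (phi : 'cV[R]_n) (alpha : 'M[R]_n).
Hypothesis pi_diag : forall j, pi j j 0 = 0.
Hypothesis alpha_sym : alpha^T = alpha.
Hypothesis shape : has_shape gamma psi pi phi alpha.

Let Pi : 'M[R]_n := \matrix_(k, j) pi j k 0.
Let S (y : 'cV[R]_n) : 'M[R]_n := alpha + Diag (Pi^T *m y) *m invmx (Diag y).

(** The degree-two part in x_J of the quadratic form of a(x) at a vector with
    J-part w, seen as a quadratic form in x_J: fixing w makes it
    polynomial in the state, so it can be scaled and moved to the
    boundary, where Diag(x_J)^-1 makes no sense. *)
Definition state_form (w : 'cV[R]_n) : 'M[R]_n :=
  \matrix_(j, k) (alpha j k * w j 0 * w k 0 + w j 0 ^+ 2 * pi j k 0).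

Lemma shapeI s t i : a (cat_point R m n s t) (lshift n i) (lshift n i) =
  gamma i 0 * s i * (1 - s i).
Proof. by have [-> _ _ _] := shape (cat_point R m n s t); rewrite col_mxKu mxE. Qed.

Lemma shapeJ s t j : a (cat_point R m n s t) (rshift m j) (rshift m j) =
  alpha j j * t j ^+ 2 + t j * (phi j 0 + \sum_k psi j k 0 * s k
                                        + \sum_k pi j k 0 * t k).
Proof.
have [_ _ -> _] := shape (cat_point R m n s t); rewrite col_mxKu col_mxKd !mxE.
congr (_ + _ * (_ + _ + _)); by apply: eq_bigr => k _; rewrite !mxE.
Qed.

Lemma quad_form_shape x (v : 'cV[R]_(m + n)) :
  let y := dsubmx x in let w := dsubmx v in
  (v^T *m a x *m v) 0 0 =
    \sum_i gamma i 0 * x (lshift n i) 0 * (1 - x (lshift n i) 0)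
           * v (lshift n i) 0 ^+ 2
    + \sum_j y j 0 * (phi j 0 + \sum_k psi j k 0 * x (lshift n k) 0) * w j 0 ^+ 2
    + (y^T *m state_form w *m y) 0 0.
Proof.
move=> y w; have [aII aI0 aJJ aJ] := shape x; rewrite -/y in aJJ aJ.
have vw k : v (rshift m k) 0 = w k 0 by rewrite mxE.
clearbody y w.
have xIE i : usubmx x i 0 = x (lshift n i) 0 by rewrite mxE.
rewrite quad_formE big_split_ord /= -addrA; congr (_ + _).
  apply: eq_bigr => i _; rewrite (bigD1 (lshift n i)) //= big1 => [|k ne].
    by rewrite addr0 aII xIE; ring.
  by rewrite aI0 1?eq_sym // mulr0 mul0r.
rewrite quad_formE -big_split; apply: eq_bigr => j _ /=.
rewrite big_split_ord /= big1 ?add0r => [|i _]; last first.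
  by rewrite a_symE aI0 ?mulr0 ?mul0r // eq_lrshift.
rewrite (bigD1 j) //= aJJ [in RHS](bigD1 (P := xpredT) (op := +%R) j) //=.
rewrite !vw !mxE pi_diag.
rewrite (bigD1 (P := xpredT) (F := fun k => (pi j)^T 0 k * y k 0) j) //= mxE pi_diag mul0r add0r.
have -> : \sum_k (psi j)^T 0 k * usubmx x k 0 = \sum_k psi j k 0 * x (lshift n k) 0.
  by apply: eq_bigr => k _; rewrite !mxE.
set sJ := \sum_(k | _) (pi j)^T 0 k * _; set sI := \sum_k psi j k 0 * _.
have -> : \sum_(k | k != j) w j 0 * a x (rshift m j) (rshift m k) * v (rshift m k) 0
    = \sum_(k | k != j) y j 0 * state_form w j k * y k 0 - w j 0 ^+ 2 * y j 0 * sJ.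
  rewrite /sJ mulr_sumr -sumrB; apply: eq_bigr => k ne.
  by rewrite aJ 1?eq_sym // vw !mxE; ring.
ring.
Qed.

(** The substitution w_j / y_j is the congruence by Diag(y) relating the
    degree-two part of a_JJ(y) to alpha + Diag(Pi^T y) Diag(y)^-1. *)
Lemma quad_form_S (y w : 'cV[R]_n) : (forall j, 0 < y j 0) ->
  (w^T *m S y *m w) 0 0 =
  (y^T *m state_form (\col_j (w j 0 / y j 0)) *m y) 0 0.
Proof.
move=> y0; have yN0 j : y j 0 != 0 by rewrite gt_eqF.
rewrite /S invmx_Diag // /Diag mulmx_diag !quad_formE; apply: eq_bigr => j _.
rewrite (eq_bigr (fun k => w j 0 * alpha j k * w k 0
   + (j == k)%:R * (w j 0 ^+ 2 / y j 0 * \sum_l pi j l 0 * y l 0))); last first.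
  move=> k _; rewrite !mxE; case: eqVneq => [<-|ne].
    rewrite mulr1n mul1r (eq_bigr (fun l => pi j l 0 * y l 0)); first by ring.
    by move=> l _; rewrite !mxE.
  by rewrite mulr0n mul0r !addr0.
rewrite big_split /= (bigD1 (P := xpredT) (F := fun k => (j == k)%:R * _) j) //=.
rewrite eqxx mul1r [X in _ + (_ + X)]big1 ?addr0 => [|k ne]; last first.
  by rewrite eq_sym (negbTE ne) mul0r.
rewrite mulr_sumr -big_split; apply: eq_bigr => k _ /=; rewrite !mxE.
by field; rewrite !yN0.
Qed.

Lemma S_sym (y : 'cV[R]_n) : (forall j, 0 < y j 0) -> (S y)^T = S y.
Proof.
move=> y0; rewrite /S invmx_Diag => [|j]; last by rewrite gt_eqF.
by rewrite /Diag mulmx_diag linearD /= alpha_sym tr_diag_mx.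
Qed.

Definition psd_parameters : Prop :=
  [/\ forall i, 0 <= gamma i 0,
      forall j k, 0 <= pi j k 0,
      forall j, \sum_k negpart (psi j k 0) <= phi j 0
    & forall y : 'cV[R]_n, (forall j, 0 < y j 0) -> psd (S y)].

(** Each constraint comes from a family of test points: the midpoint of the
    cube for gamma; x_J = e_j + r e_k with r large for pi_(j),k; x_J = r e_j
    with r small, at the vertex minimising psi_(j)^T x_I, for phi_j; and
    x_J = r y with r large for the matrix inequality. *)
Lemma condA0_parameters : condA0 (stateE R m n) a -> psd_parameters.
Proof.
move=> aA0.
have diagE s t k : (forall i, 0 <= s i <= 1) -> (forall j, 0 <= t j) ->
    0 <= a (cat_point R m n s t) k k.
  by move=> s01 t0; apply/psd_diag_ge0/aA0/cat_point_stateE.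
have z01 : 0 <= (0 : R) <= 1 by rewrite lexx ler01.
split.
- move=> i; have := diagE (fun=> 2^-1) (fun=> 0) (lshift n i).
  rewrite shapeI => h.
  have {h} : 0 <= gamma i 0 * 2^-1 * (1 - 2^-1).
    by apply: h => // _; apply/andP; split; lra.
  by move=> h; lra.
- move=> j k; have [->|ne] := eqVneq k j; first by rewrite pi_diag.
  apply: (affine_ge0_slope _ (alpha j j + phi j 0)) => r r0.
  have := diagE (fun=> 0) (fun l => if l == j then 1 else if l == k then r else 0) (rshift m j).
  rewrite shapeJ eqxx expr1n mulr1 mul1r.
  rewrite (bigD1 (P := xpredT) (F := fun l => pi j l 0 * _) j) //= pi_diag mul0r add0r.
  rewrite (bigD1 k) //= (negbTE ne) eqxx !big1 => [h|l|l _]; last 2 first.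
  + by move=> /andP[/negbTE-> /negbTE->]; rewrite mulr0.
  + by rewrite mulr0.
  have := h (fun=> z01) _; rewrite !addr0 addrA; apply=> l.
  by case: eqP => _; [exact: ler01|case: eqP => _ //; exact: ltW].
- move=> j; rewrite -subr_ge0; apply: (affine_ge0_at0 _ _ (alpha j j)) => r r0.
  have := diagE (fun k => (psi j k 0 <= 0)%R%:R) (fun l => r * (l == j)%:R) (rshift m j).
  have pit0 : \sum_k pi j k 0 * (r * (k == j)%:R) = 0.
    by rewrite big1 // => l _; case: eqVneq => [->|_]; rewrite ?pi_diag ?mul0r // !mulr0.
  rewrite shapeJ eqxx mulr1 sum_box_min pit0 => h.
  rewrite -(pmulr_rge0 _ r0).
  have {h} := h (fun k => bool_box R _) _.
  rewrite addr0 => h; apply: le_trans (h _) _.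
    by move=> l; rewrite mulr_ge0 ?ler0n // ltW.
  by rewrite le_eqVlt; apply/orP; left; apply/eqP; ring.
move=> y y0; split; first exact: S_sym.
move=> w; rewrite quad_form_S //; set u := \col_j (w j 0 / y j 0).
pose C := \sum_j y j 0 * phi j 0 * u j 0 ^+ 2.
apply: (affine_ge0_slope _ C) => r r0.
rewrite -(pmulr_rge0 _ r0).
pose v : 'cV[R]_(m + n) := col_mx 0 u.
(* At the state (0, r y) the form is r C + r^2 (w^T S(y) w); dividing by r
   leaves an affine function of r with the desired slope. *)
have := (aA0 (cat_point R m n (fun=> 0) (fun j => r * y j 0)) _).2 v.
rewrite quad_form_shape /v !col_mxKd.
have -> : \col_j (r * y j 0) = r *: y by apply/colP => j; rewrite !mxE.
rewrite quad_formZ.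
rewrite [X in X + _ + _]big1 => [|i _]; last by rewrite cat_pointI mulr0 !mul0r.
rewrite add0r (eq_bigr (fun j => r * (y j 0 * phi j 0 * u j 0 ^+ 2))); last first.
  move=> j _; rewrite big1 => [|k _]; first by rewrite mxE; ring.
  by rewrite cat_pointI mulr0.
rewrite -mulr_sumr -/C => h.
have {h} : 0 <= r * C + (y^T *m state_form u *m y) 0 0 * r ^+ 2.
  by apply: h; apply: cat_point_stateE => // j; rewrite mulr_ge0 ?ltW.
by move=> h; apply: le_trans h _; rewrite le_eqVlt; apply/orP; left; apply/eqP; ring.
Qed.

(** In the splitting of [quad_form_shape] every term is nonnegative: the second one
    since phi_j dominates the least value of psi_(j)^T x_I on the cube. *)
Lemma parameters_condA0 : psd_parameters -> condA0 (stateE R m n) a.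
Proof.
move=> [gamma0 pi0 phi0 S0] x [xI xJ]; split=> // v.
rewrite quad_form_shape; set y := dsubmx x; set w := dsubmx v.
have y0 j : 0 <= y j 0 by rewrite mxE.
have state_form_ge0 (z : 'cV[R]_n) : (forall j, 0 < z j 0) ->
    0 <= (z^T *m state_form w *m z) 0 0.
  move=> z0; have := (S0 z z0).2 (\col_j (w j 0 * z j 0)).
  rewrite quad_form_S //; set u := (X in state_form X); suff -> : u = w by [].
  by apply/colP => j; rewrite mxE mxE mulfK // gt_eqF.
apply: addr_ge0; first apply: addr_ge0.
- apply: sumr_ge0 => i _; have /andP[x0 x1] := xI i.
  by rewrite mulr_ge0 ?sqr_ge0 // mulr_ge0 ?subr_ge0 // mulr_ge0.
- apply: sumr_ge0 => j _; rewrite mulr_ge0 ?sqr_ge0 // mulr_ge0 //.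
  have := @sum_box_ge R m xpredT (fun k => psi j k 0) (fun k => x (lshift n k) 0) xI.
  by have := phi0 j => ? ?; lra.
(* Some y_j may be 0: move to the interior point y + r 1 and let r tend to 0. *)
pose e : 'cV[R]_n := const_mx 1; pose N := state_form w.
apply: (quadratic_ge0_at0 _ _ ((y^T *m N *m e) 0 0 + (e^T *m N *m y) 0 0)
  ((e^T *m N *m e) 0 0)) => r r0.
rewrite -quad_form_shift; apply: state_form_ge0 => j.
have -> : (y + r *: e) j 0 = y j 0 + r by rewrite !mxE mulr1.
by rewrite ltr_wpDl.
Qed.

Lemma shape_tangential : tangential R m n a.
Proof.
split=> [k x xk i|i0 x xi i]; have [aII aI0 aJJ aJ] := shape x.
  case: (splitP k) => j kj.
    have ek : k = lshift n j by apply: val_inj.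
    rewrite a_symE ek; have [<-|ne] := eqVneq (lshift n j) i; last exact: aI0.
    by rewrite aII mxE -ek xk mulr0 mul0r.
  have ek : k = rshift m j by apply: val_inj.
  have yj : dsubmx x j 0 = 0 by rewrite mxE -ek.
  rewrite ek; case: (splitP i) => l il.
    have -> : i = lshift n l by apply: val_inj.
    by rewrite aI0 // eq_lrshift.
  have -> : i = rshift m l by apply: val_inj.
  have [->|ne] := eqVneq l j; first by rewrite aJJ yj expr0n mulr0 mul0r addr0.
  by rewrite aJ // yj mulr0.
rewrite a_symE; have [<-|ne] := eqVneq (lshift n i0) i; last exact: aI0.
by rewrite aII mxE xi subrr mulr0.
Qed.

End Shape.

Lemma form_aP : (forall i j, is_Pol 2 (fun x => a x i j)) ->
  (condA0 (stateE R m n) a /\ tangential R m n a) <-> form_a a.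
Proof.
have onesE (u : 'cV[R]_m) :
    ((map_mx (@negpart R) u)^T *m ones R m) 0 0 = \sum_k negpart (u k 0).
  by rewrite mxE; apply: eq_bigr => k _; rewrite !mxE mulr1.
move=> a2; split.
  move=> [aA0 /(tangential_shape a2)[gamma [psi [pi [phi [alpha [pid als sh]]]]]]].
  have [g0 p0 ph0 S0] := condA0_parameters _ _ _ _ _ pid als sh aA0.
  exists gamma, psi, pi, phi, alpha; split=> // j; rewrite onesE; exact: ph0.
move=> [gamma [psi [pi [phi [alpha [[g0 p0 pid] ph0 als S0 sh]]]]]].
split; last exact: shape_tangential sh.
apply: (parameters_condA0 gamma psi pi phi alpha) => //.
by split=> // j; rewrite -onesE.
Qed.

End Diffusion.

(** * Geometry of the state space and the equivalence *)

Lemma condG1_nil (R : realType) (m n : nat) :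
  condG1 (manifoldM R m n) (polysQ R m n).
Proof. by move=> x _; rewrite /row_free -leqn0 rank_leq_row. Qed.

Lemma condG2_cube (R : realType) (m n : nat) :
  condG2 (manifoldM R m n) (polysP R m n) (polysQ R m n).
Proof.
move=> p; have idealE (q f : {mpoly R[m + n]}) :
    ideal_gen (rcons [::] q) f <-> exists g, f = g * q.
  split=> [[g ->]|[g ->]]; first by exists (g ord0); rewrite big_ord1.
  by exists (fun=> g); rewrite big_ord1.
rewrite mem_cat => /orP[] /mapP[k _ ->]; apply/seteqP; split=> f.
- move=> /idealE[g ->] x [_ /zero_setX xk].
  by rewrite /peval mevalM mevalXU xk mulr0.
- move=> f0; apply/idealE; have [|q ->] := factor_coord R _ k 0 f.
    by move=> x xk; apply: f0; split=> //; apply/zero_setX.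
  by exists q; rewrite mpolyC0 subr0 mulrC.
- move=> /idealE[g ->] x [_ /zero_set1BX xk].
  by rewrite /peval mevalM mevalB meval1 mevalXU xk subrr mulr0.
move=> f0; apply/idealE; have [|q ->] := factor_coord R _ (lshift n k) 1 f.
  by move=> x xk; apply: f0; split=> //; apply/zero_set1BX.
by exists (- q); rewrite mpolyC1; ring.
Qed.

Theorem proposition6p4 (R : realType) (m n : nat)
    (a : 'cV[R]_(m + n) -> 'M[R]_(m + n))
    (b : 'cV[R]_(m + n) -> 'cV[R]_(m + n))
    (a_sym : forall x, (a x)^T = a x)
    (a_pol : forall i j, is_Pol 2 (fun x => a x i j))
    (b_pol : forall i, is_Pol 1 (fun x => b x i 0)) :
  let E := stateE R m n in
  let P := polysP R m n in
  let Q := polysQ R m n in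
  let M := manifoldM R m n in
  (condG1 M Q /\ condG2 M P Q) /\
  ((condA0 E a /\ condA1 M E P a b /\ condA2 M Q a b) <->
   (form_a a /\ form_b b)).
Proof.
move=> E P Q M; split; first by split; [exact: condG1_nil|exact: condG2_cube].
split=> [[aA0 [/condA1P[tan inw] _]]|[fa fb]].
  split; last exact: inwardP.
  by apply/form_aP.
have /form_aP[] := fa => // aA0 tan.
split=> //; split=> //; apply/condA1P; split=> //.
exact: form_b_inward.
Qed.
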